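(* Let $V\subseteq\mathbb{R}^n$ be any real algebraic variety. Then: (i) there exists a finite normal form game with $3$ players whose set of totally mixed Nash equilibria is stably isomorphic to $V$; and (ii) there exists a finite normal form game with some number $N$ of players, each of whom has exactly two pure strategies, whose set of totally mixed Nash equilibria is stably isomorphic to $V$.
   Context: A real algebraic variety is the set of common real zeros in $\mathbb{R}^n$ of finitely many real polynomials; a semialgebraic set is a subset of some $\mathbb{R}^k$ defined by a finite Boolean combination of real polynomial equations and inequalities. Two semialgebraic sets are semialgebraically isomorphic if there is a homeomorphism between them whose graph is a semialgebraic set. Two semialgebraic sets are stably isomorphic if they are equivalent under the equivalence relation generated by semialgebraic isomorphisms and the canonical projections $W\times\mathbb{R}^k\to W$ ($k\ge 0$). A finite normal form game consists of players $I=\{1,\dots,N\}$, finite pure strategy sets $S_i=\{s_{i0},\dots,s_{id_i}\}$, and payoff functions $u_i:S=\prod_i S_i\to\mathbb{R}$. A mixed strategy of player $i$ is a function $\sigma_i:S_i\to[0,1]$ with $\sum_{s\in S_i}\sigma_i(s)=1$; a strategy profile is $\sigma=(\sigma_1,\dots,\sigma_N)$, and the expected payoff is $u_i(\sigma)=\sum_{s\in S}u_i(s)\sigma_1(s_1)\cdots\sigma_N(s_N)$. We write $u_i(s_{ij},\sigma_{-i})$ for the expected payoff of player $i$ when $i$ plays the pure strategy $s_{ij}$ and the others play according to $\sigma$. A profile $\sigma$ is a totally mixed Nash equilibrium if $0<\sigma_i(s_{ij})<1$ for all $i,j$ and $u_i(s_{ij},\sigma_{-i})=u_i(s_{i0},\sigma_{-i})$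 for all $i$ and all $j=1,\dots,d_i$. The set of totally mixed Nash equilibria is regarded as a semialgebraic subset of $\mathbb{R}^{\sum_i d_i}$ via the coordinates $(\sigma_i(s_{ij}))_{i\in I,\,1\le j\le d_i}$. *)

(* Defs.v *)
From HB Require Import structures.
From mathcomp Require Import all_boot all_order all_algebra.
From mathcomp Require Import all_classical all_reals all_analysis.

Set Implicit Arguments.
Unset Strict Implicit.
Unset Printing Implicit Defensive.

Import Order.TTheory GRing.Theory Num.Theory.
Import numFieldNormedType.Exports.
Local Open Scope classical_set_scope.
Local Open Scope ring_scope.

Section Semialgebraic.
Variable R : realType.

Inductive rpoly (V : Type) : Type :=
| PVar of V
| PConst of R
| PAdd of rpoly V & rpoly V
| PMul of rpoly V & rpoly V
| POpp of rpoly V.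

Fixpoint peval (V : Type) (p : rpoly V) (x : V -> R) : R :=
  match p with
  | PVar v => x v
  | PConst c => c
  | PAdd p q => peval p x + peval q x
  | PMul p q => peval p x * peval q x
  | POpp p => - peval p x
  end.

Inductive saformula (V : Type) : Type :=
| FEq0 of rpoly V
| FGt0 of rpoly V
| FNot of saformula V
| FAnd of saformula V & saformula V
| FOr of saformula V & saformula V.

Fixpoint fholds (V : Type) (f : saformula V) (x : V -> R) : Prop :=
  match f with
  | FEq0 p => peval p x = 0
  | FGt0 p => 0 < peval p x
  | FNot f => ~ fholds f x
  | FAnd f g => fholds f x /\ fholds g x
  | FOr f g => fholds f x \/ fholds g x
  end.

Definition coords (k : nat) (x : 'rV[R]_k) : 'I_k -> R := fun i => x ord0 i.

Definition real_algebraic_variety (n : nat) (V : set 'rV[R]_n) : Prop :=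
  exists (m : nat) (ps : 'I_m -> rpoly 'I_n),
    V = [set x | forall i : 'I_m, peval (ps i) (coords x) = 0].

Definition semialgebraic (k : nat) (A : set 'rV[R]_k) : Prop :=
  exists f : saformula 'I_k, A = [set x | fholds f (coords x)].

Definition sa_isomorphic (m n : nat) (A : set 'rV[R]_m) (B : set 'rV[R]_n)
  : Prop :=
  exists (f : 'rV[R]_m -> 'rV[R]_n) (g : 'rV[R]_n -> 'rV[R]_m),
    [/\ f @` A `<=` B, g @` B `<=` A,
        {in A, cancel f g} & {in B, cancel g f}] /\
    [/\ {within A, continuous f}, {within B, continuous g} &
        semialgebraic [set row_mx x (f x) | x in A]].

Record rset := RSet { rdim : nat; rpts : set 'rV[R]_rdim }.

Definition times_Rk (m k : nat) (W : set 'rV[R]_m) : set 'rV[R]_(m + k) :=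
  [set row_mx x y | x in W & y in [set: 'rV[R]_k]].

Inductive stably_isomorphic : rset -> rset -> Prop :=
| stiso_iso (m n : nat) (A : set 'rV[R]_m) (B : set 'rV[R]_n) :
    semialgebraic A -> semialgebraic B -> sa_isomorphic A B ->
    stably_isomorphic (RSet A) (RSet B)
| stiso_proj (m k : nat) (W : set 'rV[R]_m) :
    semialgebraic W ->
    stably_isomorphic (RSet (@times_Rk m k W)) (RSet W)
| stiso_sym (X Y : rset) : stably_isomorphic X Y -> stably_isomorphic Y X
| stiso_trans (X Y Z : rset) :
    stably_isomorphic X Y -> stably_isomorphic Y Z -> stably_isomorphic X Z.

(* N players 'I_N; player i has pure strategies 'I_(d i).+1 = {s_i0,...,s_id_i};
   u i s is the payoff of player i at the pure profile s. *)
Definition pure_profile (N : nat) (d : 'I_N -> nat) : finType :=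
  {dffun forall i : 'I_N, 'I_(d i).+1}.

(* Index set of the coordinates sigma_i(s_ij), i in I, 1 <= j <= d_i
   (j is stored as j-1 : 'I_(d i)).  It has \sum_i d_i elements. *)
Definition coord_index (N : nat) (d : 'I_N -> nat) : finType :=
  {i : 'I_N & 'I_(d i)}.

(* The mixed strategy profile determined by a point of R^(\sum_i d_i):
   sigma_i(s_ij) = coordinate (i,j) for j >= 1, sigma_i(s_i0) = 1 - sum. *)
Definition profile_of (N : nat) (d : 'I_N -> nat)
  (x : 'rV[R]_#|coord_index d|) (i : 'I_N) (j : 'I_(d i).+1) : R :=
  let c := fun j' : 'I_(d i) =>
             x ord0 (enum_rank (existT (fun i0 : 'I_N => 'I_(d i0)) i j' : coord_index d)) in
  match unlift ord0 j with
  | Some j' => c j'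
  | None => 1 - \sum_(j' : 'I_(d i)) c j'
  end.

Arguments profile_of {N d} x i j.

Definition dev_payoff (N : nat) (d : 'I_N -> nat)
  (u : 'I_N -> pure_profile d -> R)
  (sigma : forall i : 'I_N, 'I_(d i).+1 -> R) (i : 'I_N) (k : 'I_(d i).+1) : R :=
  \sum_(s : pure_profile d | s i == k)
     u i s * \prod_(j : 'I_N | j != i) sigma j (s j).

Arguments dev_payoff {N d} u sigma i k.

Definition totally_mixed_NE (N : nat) (d : 'I_N -> nat)
  (u : 'I_N -> pure_profile d -> R) : set 'rV[R]_#|coord_index d| :=
  [set x | let sigma := profile_of x in
     (forall (i : 'I_N) (j : 'I_(d i).+1), 0 < sigma i j < 1) /\
     (forall (i : 'I_N) (j : 'I_(d i).+1),
        dev_payoff u sigma i j = dev_payoff u sigma i ord0)].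

End Semialgebraic.

(* Main.v *)
(** Write [V] as the zero set of one polynomial and evaluate it by an arithmetic
    circuit.  Each node value [v] is encoded by two positive numbers [P, Q] with
    [P Q = 1] and [v = (P - Q) / 2]; dividing [(1, P, Q, ...)] by its sum turns
    [V] into the set of points of an open simplex on which finitely many
    quadratic forms vanish.  Two copies of the simplex point make these forms
    bilinear, so each is the indifference condition of an extra player (or of an
    extra pure strategy of a third player) facing players with zero payoffs.  The
    mixed strategies of the extra players are unconstrained, and an open simplex
    is semialgebraically a Euclidean space. *)

Require Import Defs.
From HB Require Import structures.
From mathcomp Require Import all_boot all_order all_algebra.
From mathcomp Require Import all_classical all_reals all_analysis.
From mathcomp Require Import ring lra.

Set Implicit Arguments.
Unset Strict Implicit.
Unset Printing Implicit Defensive.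

Import Order.TTheory GRing.Theory Num.Theory.
Import numFieldNormedType.Exports.
Local Open Scope classical_set_scope.
Local Open Scope ring_scope.

(** * Polynomials, formulas and continuity *)

Section Polynomials.
Variable R : realType.

Definition rpoly_sum (V : Type) (I : finType) (P : pred I) (F : I -> rpoly R V)
  : rpoly R V := \big[@PAdd R V/PConst V 0]_(i | P i) F i.

Definition rpoly_prod (V : Type) (I : finType) (P : pred I) (F : I -> rpoly R V)
  : rpoly R V := \big[@PMul R V/PConst V 1]_(i | P i) F i.

Lemma peval_sum (V : Type) (I : finType) (P : pred I) (F : I -> rpoly R V) x :
  peval (rpoly_sum P F) x = \sum_(i | P i) peval (F i) x.
Proof. exact: (big_morph (fun p => peval p x)). Qed.

Lemma peval_prod (V : Type) (I : finType) (P : pred I) (F : I -> rpoly R V) x :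
  peval (rpoly_prod P F) x = \prod_(i | P i) peval (F i) x.
Proof. exact: (big_morph (fun p => peval p x)). Qed.

Fixpoint rpoly_map (V W : Type) (h : V -> W) (p : rpoly R V) : rpoly R W :=
  match p with
  | PVar v => PVar R (h v)
  | PConst c => PConst W c
  | PAdd p q => PAdd (rpoly_map h p) (rpoly_map h q)
  | PMul p q => PMul (rpoly_map h p) (rpoly_map h q)
  | POpp p => POpp (rpoly_map h p)
  end.

Lemma peval_map (V W : Type) (h : V -> W) p x :
  peval (rpoly_map h p) x = peval p (x \o h).
Proof. by elim: p => //= [p -> q ->|p -> q ->|p ->]. Qed.

Fixpoint saformula_map (V W : Type) (h : V -> W) (f : saformula R V)
  : saformula R W :=
  match f with
  | FEq0 p => FEq0 (rpoly_map h p)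
  | FGt0 p => FGt0 (rpoly_map h p)
  | FNot f => FNot (saformula_map h f)
  | FAnd f g => FAnd (saformula_map h f) (saformula_map h g)
  | FOr f g => FOr (saformula_map h f) (saformula_map h g)
  end.

Lemma fholds_map (V W : Type) (h : V -> W) f x :
  fholds (saformula_map h f) x <-> fholds f (x \o h).
Proof. by elim: f => /= [p|p|f IHf|f IHf g IHg|f IHf g IHg]; rewrite ?peval_map //; tauto. Qed.

(** The trivial equation [0 = 0] serves as the empty conjunction. *)
Definition saformula_all (V : Type) (I : finType) (F : I -> saformula R V)
  : saformula R V := foldr (fun i => FAnd (F i)) (FEq0 (PConst V 0)) (enum I).

Lemma fholds_all (V : Type) (I : finType) (F : I -> saformula R V) x :
  fholds (saformula_all F) x <-> forall i, fholds (F i) x.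
Proof.
rewrite /saformula_all.
suff H : fholds (foldr (fun i => FAnd (F i)) (FEq0 (PConst V 0)) (enum I)) x <->
    {in enum I, forall i, fholds (F i) x}.
  split=> [/H Fx i|Fx]; first by apply: Fx; rewrite mem_enum.
  by apply/H => i _.
elim: (enum I) => [|i s IH] /=; first by split.
split=> [[Fi /IH Fs] j|H].
  by rewrite inE => /orP[/eqP ->|/Fs].
by split; [apply: H; rewrite mem_head|apply/IH => j js; apply: H; rewrite inE js orbT].
Qed.

Lemma cvg_row (T : topologicalType) (n : nat) (f : T -> 'rV[R]_n) (x : T) :
  (forall j, f y ord0 j @[y --> x] --> f x ord0 j) -> f y @[y --> x] --> f x.
Proof.
move=> fx A /nbhs_ballP[e /= e0 eA].
have : \forall y \near x, forall j, ball (f x ord0 j) e (f y ord0 j).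
  apply: filter_forall => j; apply: (fx j); exact: nbhsx_ballx.
apply: filterS => y fy; apply: eA; split => // i j.
rewrite (ord1 i); exact: fy.
Qed.

Lemma cvg_quot (T : topologicalType) (f g : T -> R) (t : T) :
  g t != 0 -> f u @[u --> t] --> f t -> g u @[u --> t] --> g t ->
  f u / g u @[u --> t] --> f t / g t.
Proof.
move=> gt0 ft gt; apply: (@cvgM _ _ _ _ f (fun u => (g u)^-1)) => //.
exact: (@cvgV _ _ _ _ g).
Qed.

Lemma cvg_onem (T : topologicalType) (f : T -> R) (t : T) :
  f u @[u --> t] --> f t -> 1 - f u @[u --> t] --> 1 - f t.
Proof. by move=> ft; apply: cvgB => //; exact: cvg_cst. Qed.

Lemma cvg_finsum (T : topologicalType) (I : finType) (P : pred I)
    (f : I -> T -> R) (t : T) :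
  (forall i, f i u @[u --> t] --> f i t) ->
  \sum_(i | P i) f i u @[u --> t] --> \sum_(i | P i) f i t.
Proof.
move=> ft; elim: (index_enum I) => [|i s IH].
  by under eq_fun do rewrite big_nil; rewrite big_nil; exact: cvg_cst.
under eq_fun do rewrite big_cons; rewrite big_cons.
by case: (P i) => //; apply: cvgD => //; exact: ft.
Qed.

Lemma cvg_peval (T : topologicalType) (V : Type) (p : rpoly R V)
    (x : T -> V -> R) (t : T) :
  (forall v, x u v @[u --> t] --> x t v) ->
  peval p (x u) @[u --> t] --> peval p (x t).
Proof.
move=> xt; elim: p => /= [v|c|p IHp q IHq|p IHp q IHq|p IHp].
- exact: xt.
- exact: cvg_cst.
- exact: cvgD.
- exact: cvgM.
- exact: cvgN.
Qed.

Lemma cvg_coords (n : nat) (x : 'rV[R]_n) j :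
  coords y j @[y --> x] --> coords x j.
Proof. exact: coord_continuous. Qed.

Lemma coords_lshift (m n : nat) (z : 'rV[R]_(m + n)) :
  coords z \o lshift n = coords (lsubmx z).
Proof. by apply/funext => i; rewrite /coords/= mxE. Qed.

Definition rational_map (m n : nat) (num den : 'I_n -> rpoly R 'I_m)
  (x : 'rV[R]_m) : 'rV[R]_n :=
  \row_j (peval (num j) (coords x) / peval (den j) (coords x)).

Lemma rational_map_continuous (m n : nat) (num den : 'I_n -> rpoly R 'I_m)
    (A : set 'rV[R]_m) :
  (forall x j, A x -> peval (den j) (coords x) != 0) ->
  {within A, continuous (rational_map num den)}.
Proof.
move=> den0; apply: continuous_in_subspaceT => x /set_mem Ax.
apply: cvg_row => j; rewrite [X in _ --> X]mxE.
under eq_fun do rewrite mxE.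
apply: (cvg_quot (den0 _ _ Ax));
  by apply: (@cvg_peval _ _ _ (@coords R m)) => v; apply: cvg_coords.
Qed.

(** Clearing denominators describes the graph by polynomial equations [den j * z_j = num j]; where
    the denominators do not vanish these are equivalent to the quotients. *)
Lemma rational_map_graph (m n : nat) (num den : 'I_n -> rpoly R 'I_m)
    (A : set 'rV[R]_m) :
  semialgebraic A -> (forall x j, A x -> peval (den j) (coords x) != 0) ->
  semialgebraic [set row_mx x (rational_map num den x) | x in A].
Proof.
move=> [f Af] den0.
pose graph_eq j := FEq0 (PAdd (PMul (rpoly_map (lshift n) (den j)) (PVar R (rshift m j)))
  (POpp (rpoly_map (lshift n) (num j)))).
exists (FAnd (saformula_map (lshift n) f) (saformula_all graph_eq)).
apply/seteqP; split=> [z [x Ax <-]|z /= [/fholds_map fz /fholds_all zg]] /=.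
  split; first by apply/fholds_map; rewrite coords_lshift row_mxKl; rewrite Af in Ax.
  apply/fholds_all => j /=; rewrite !peval_map coords_lshift row_mxKl.
  by rewrite {2}/coords row_mxEr mxE mulrC divfK ?subrr ?den0.
have Az : A (lsubmx z) by rewrite Af /= -coords_lshift.
exists (lsubmx z) => //; rewrite -[RHS]hsubmxK; congr row_mx.
apply/rowP => j; have := zg j; rewrite /= !peval_map coords_lshift => /eqP.
rewrite subr_eq0 => /eqP dz; rewrite !mxE -dz mulrC mulKf ?den0 //.
Qed.

Lemma semialgebraic_times (m k : nat) (W : set 'rV[R]_m) :
  semialgebraic W -> semialgebraic (@times_Rk R m k W).
Proof.
move=> [f ->]; exists (saformula_map (lshift k) f).
apply/seteqP; split=> [z [x fx [y _ <-]]|z /= /fholds_map]; rewrite ?coords_lshift /=.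
  by apply/fholds_map; rewrite coords_lshift row_mxKl.
by move=> fz; exists (lsubmx z) => //; exists (rsubmx z) => //; rewrite hsubmxK.
Qed.

Lemma variety_semialgebraic (n : nat) (V : set 'rV[R]_n) :
  real_algebraic_variety V -> semialgebraic V.
Proof.
move=> [m [ps ->]]; exists (saformula_all (fun i => FEq0 (ps i))).
by apply/seteqP; split=> x /= H; [apply/fholds_all|move/fholds_all: H].
Qed.

(** Over the reals a sum of squares vanishes exactly when every term does. *)
Lemma variety_hypersurface (n : nat) (V : set 'rV[R]_n) :
  real_algebraic_variety V ->
  exists p : rpoly R 'I_n, V = [set x | peval p (coords x) = 0].
Proof.
move=> [m [ps ->]]; exists (rpoly_sum predT (fun i => PMul (ps i) (ps i))).
apply/seteqP; split=> x /=; rewrite peval_sum.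
  by move=> H; rewrite big1 // => i _ /=; rewrite H mul0r.
move=> /eqP; rewrite psumr_eq0 => [|i _ /=]; last exact: sqr_ge0.
move=> /allP H i; have := H i (mem_index_enum i).
by rewrite /= mulf_eq0 orbb => /eqP.
Qed.

End Polynomials.

(** * Quadratic normal form of a variety in an open simplex *)

Section ExpAsinh.
Variable R : realType.

(* [expasinh w] is the exponential of the inverse hyperbolic sine of [w], an
   algebraic homeomorphism from the line to the positive half-line. *)
Definition expasinh (w : R) : R := w + Num.sqrt (1 + w ^+ 2).

Lemma expasinhN (w : R) : expasinh w * expasinh (- w) = 1.
Proof.
rewrite /expasinh sqrrN; have : Num.sqrt (1 + w ^+ 2) ^+ 2 = 1 + w ^+ 2.
  by rewrite sqr_sqrtr // addr_ge0 // sqr_ge0.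
by move: (Num.sqrt _) => r rE; ring: rE.
Qed.

Lemma expasinhB (w : R) : expasinh w - expasinh (- w) = w *+ 2.
Proof. by rewrite /expasinh sqrrN; ring. Qed.

(** The numbers [expasinh w] and [expasinh (- w)] have product 1 and a nonnegative sum, so both are
    positive. *)
Lemma expasinh_gt0 (w : R) : 0 < expasinh w.
Proof.
have ge0 : 0 <= expasinh w + expasinh (- w).
  rewrite /expasinh sqrrN addrACA subrr add0r.
  by rewrite addr_ge0 // sqrtr_ge0.
have := expasinhN w; move: (expasinh w) (expasinh (- w)) ge0 => a b ab0 ab1.
nra.
Qed.

(** When [a * b = 1], adding 1 to the square of [(a - b) / 2] gives the square of [(a + b) / 2].
    Half the difference is thus a global parameter of the positive branch of the hyperbola. *)
Lemma expasinh_hyperbola (a b : R) : 0 < a -> 0 < b -> a * b = 1 ->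
  expasinh ((a - b) / 2) = a.
Proof.
move=> a0 b0 ab; rewrite /expasinh.
have -> : 1 + ((a - b) / 2) ^+ 2 = ((a + b) / 2) ^+ 2 by field: ab.
by rewrite sqrtr_sqr ger0_norm; [field|lra].
Qed.

(** The argument is half the difference of the reciprocal numbers [a / b] and [b / a]. Hence the
    parameter is a rational function of [a] and [b], although [expasinh] itself contains a square
    root. *)
Lemma expasinh_ratio (a b : R) : 0 < a -> 0 < b ->
  expasinh ((a ^+ 2 - b ^+ 2) / (2 * (a * b))) * b = a.
Proof.
move=> a0 b0; have [an bn] : a != 0 /\ b != 0 by rewrite !gt_eqF.
have -> : (a ^+ 2 - b ^+ 2) / (2 * (a * b)) = (a / b - b / a) / 2.
  by field; rewrite an.
by rewrite expasinh_hyperbola ?divr_gt0 ?divfK //; field; rewrite an.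
Qed.

Lemma ratio_expasinh (w b : R) : b != 0 ->
  ((expasinh w * b) ^+ 2 - b ^+ 2) / (2 * (expasinh w * b * b)) = w.
Proof.
move=> bn; have := expasinhN w; have := expasinhB w.
have := lt0r_neq0 (expasinh_gt0 w).
move: (expasinh w) (expasinh (- w)) => a c an ac2 ac1.
have -> : w = (a - c) / 2 by rewrite ac2; field.
have -> : c = a^-1 by apply: (mulfI an); rewrite ac1 divff.
by field; rewrite an bn.
Qed.

Lemma cvg_expasinh (T : topologicalType) (f : T -> R) (t : T) :
  f u @[u --> t] --> f t -> expasinh (f u) @[u --> t] --> expasinh (f t).
Proof.
move=> ft; apply: cvgD => //.
have gt : 1 + f u ^+ 2 @[u --> t] --> 1 + f t ^+ 2.
  by apply: cvgD; [exact: cvg_cst|rewrite expr2; exact: cvgM].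
apply: (@cvg_comp _ _ _ _ Num.sqrt _ _ _ gt); exact: sqrt_continuous.
Qed.

(** Unnormalized coordinates of an algebraic variant of softmax: coordinate 0 is the reference, and
    [expasinh] replaces the exponential so that the chart stays semialgebraic. *)
Definition chart_raw (m : nat) (w : 'I_m -> R) (i : 'I_m.+1) : R :=
  if unlift ord0 i is Some j then expasinh (w j) else 1.

Definition simplex_chart (m : nat) (w : 'I_m -> R) (i : 'I_m.+1) : R :=
  chart_raw w i / \sum_j chart_raw w j.

Lemma chart_raw_gt0 m (w : 'I_m -> R) i : 0 < chart_raw w i.
Proof.
by rewrite /chart_raw; case: (unlift _ _) => // j; exact: expasinh_gt0.
Qed.

Lemma chart_raw_sum_gt0 m (w : 'I_m -> R) : 0 < \sum_j chart_raw w j.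
Proof.
rewrite big_ord_recl; apply: ltr_wpDr (chart_raw_gt0 _ _).
by apply: sumr_ge0 => i _; exact/ltW/chart_raw_gt0.
Qed.

Lemma simplex_chart_gt0 m (w : 'I_m -> R) i : 0 < simplex_chart w i.
Proof. by rewrite divr_gt0 ?chart_raw_gt0 ?chart_raw_sum_gt0. Qed.

Lemma simplex_chart_sum m (w : 'I_m -> R) : \sum_i simplex_chart w i = 1.
Proof. by rewrite -mulr_suml divff // gt_eqF ?chart_raw_sum_gt0. Qed.

Lemma simplex_chart_lift m (w : 'I_m -> R) j :
  simplex_chart w (lift ord0 j) = expasinh (w j) * simplex_chart w ord0.
Proof. by rewrite /simplex_chart /chart_raw liftK unlift_none mul1r. Qed.

(** The ratios to coordinate 0 fix [a] up to a factor, and the total mass 1 fixes the factor. *)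
Lemma simplex_chart_unique m (w : 'I_m -> R) (a : 'I_m.+1 -> R) :
  \sum_i a i = 1 -> (forall j, a (lift ord0 j) = expasinh (w j) * a ord0) ->
  a = simplex_chart w.
Proof.
move=> a1 aw; have rawE i : a i = chart_raw w i * a ord0.
  rewrite /chart_raw; case: (unliftP ord0 i) => [j ->|->]; first exact: aw.
  by rewrite mul1r.
apply/funext => i; rewrite rawE; congr (_ * _).
move: a1; under eq_bigr do rewrite rawE.
rewrite -mulr_suml => a1; have raw0 := lt0r_neq0 (chart_raw_sum_gt0 w).
by apply: (mulfI raw0); rewrite a1 divff.
Qed.

Lemma cvg_simplex_chart (T : topologicalType) m (w : T -> 'I_m -> R) (t : T) i :
  (forall j, w u j @[u --> t] --> w t j) ->
  simplex_chart (w u) i @[u --> t] --> simplex_chart (w t) i.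
Proof.
move=> wt; have rawt j : chart_raw (w u) j @[u --> t] --> chart_raw (w t) j.
  rewrite /chart_raw; case: (unlift _ _) => [j'|]; last exact: cvg_cst.
  exact: (@cvg_expasinh _ (fun u => w u j')).
apply: (@cvg_quot _ _ (fun u => chart_raw (w u) i)
  (fun u => \sum_j chart_raw (w u) j)) => //.
  by rewrite gt_eqF ?chart_raw_sum_gt0.
by apply: (@cvg_finsum _ _ _ _ (fun j u => chart_raw (w u) j)).
Qed.

End ExpAsinh.

(** * Polynomials as systems of gate equations *)

Section Circuits.
Variable R : realType.

Inductive gate (K : Type) : Type :=
| GConst of K & R
| GAdd of K & K & K
| GMul of K & K & K
| GOpp of K & K.

Definition gate_holds (K : Type) (v : K -> R) (g : gate K) : Prop :=
  match g with
  | GConst k c => v k = c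
  | GAdd k i j => v k = v i + v j
  | GMul k i j => v k = v i * v j
  | GOpp k i => v k = - v i
  end.

Definition gate_map (K L : Type) (h : K -> L) (g : gate K) : gate L :=
  match g with
  | GConst k c => GConst (h k) c
  | GAdd k i j => GAdd (h k) (h i) (h j)
  | GMul k i j => GMul (h k) (h i) (h j)
  | GOpp k i => GOpp (h k) (h i)
  end.

Lemma gate_holds_map (K L : Type) (h : K -> L) (v : L -> R) (g : gate K) :
  gate_holds v (gate_map h g) <-> gate_holds (v \o h) g.
Proof. by case: g. Qed.

Definition sum_env (I T : Type) (x : I -> R) (z : T -> R) (k : I + T) : R :=
  match k with inl i => x i | inr t => z t end.

(** Nodes are the inputs [I] and the internal wires [T]. The gates hold exactly when each wire
    carries its prescribed polynomial in the inputs, so the solutions form a graph over the input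
    space and the wires add no freedom. The output [o] may itself be an input, which covers a
    circuit without wires. *)
Definition computed_by (I T G : Type) (gs : G -> gate (I + T)%type)
  (o : (I + T)%type) (h : T -> rpoly R I) (p : rpoly R I) : Prop :=
  forall (x : I -> R) (z : T -> R),
    ((forall g, gate_holds (sum_env x z) (gs g)) <->
     (forall t, z t = peval (h t) x)) /\
    ((forall t, z t = peval (h t) x) -> sum_env x z o = peval p x).

(** The two circuits are placed side by side on shared inputs, and one new wire [None] with one new
    gate combines their outputs. Abstracting over [op] treats all operations at once. *)
Lemma computed_by_binary (I : Type) (p q r : rpoly R I)
    (op : forall K, K -> K -> K -> gate K) (f : R -> R -> R) :
  (forall K (v : K -> R) k i j,
     gate_holds v (op K k i j) <-> v k = f (v i) (v j)) ->
  (forall x, peval r x = f (peval p x) (peval q x)) ->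
  (exists (T G : finType) gs o h, @computed_by I T G gs o h p) ->
  (exists (T G : finType) gs o h, @computed_by I T G gs o h q) ->
  exists (T G : finType) gs o h, @computed_by I T G gs o h r.
Proof.
move=> opE rE [T1 [G1 [gs1 [out1 [h1 H1]]]]] [T2 [G2 [gs2 [out2 [h2 H2]]]]].
pose T : finType := option (T1 + T2)%type.
pose G : finType := option (G1 + G2)%type.
pose l1 (k : I + T1) : I + T :=
  match k with inl i => inl i | inr t => inr (Some (inl t)) end.
pose l2 (k : I + T2) : I + T :=
  match k with inl i => inl i | inr t => inr (Some (inr t)) end.
pose gs (g : G) := match g with
  | Some (inl g) => gate_map l1 (gs1 g)
  | Some (inr g) => gate_map l2 (gs2 g)
  | None => op _ (inr None) (l1 out1) (l2 out2) end.
pose h (t : T) := match t with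
  | Some (inl t) => h1 t | Some (inr t) => h2 t | None => r end.
exists T, G, gs, (inr None), h => x z.
pose z1 t := z (Some (inl t)); pose z2 t := z (Some (inr t)).
have E1 : sum_env x z \o l1 = sum_env x z1 by apply/funext => -[].
have E2 : sum_env x z \o l2 = sum_env x z2 by apply/funext => -[].
have e1 k : sum_env x z (l1 k) = sum_env x z1 k by rewrite -E1.
have e2 k : sum_env x z (l2 k) = sum_env x z2 k by rewrite -E2.
have [g1 v1] := H1 x z1; have [g2 v2] := H2 x z2.
split; last by move=> /(_ None).
split=> [Hg|Hz].
  have z1E : forall t, z1 t = peval (h1 t) x.
    by apply/g1 => g; rewrite -E1; apply/gate_holds_map; exact: (Hg (Some (inl g))).
  have z2E : forall t, z2 t = peval (h2 t) x.
    by apply/g2 => g; rewrite -E2; apply/gate_holds_map; exact: (Hg (Some (inr g))).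
  move=> [[t|t]|]; [exact: z1E|exact: z2E|].
  have /opE /= := Hg None; rewrite e1 e2 v1 // v2 // => ->.
  by rewrite rE.
have z1E : forall t, z1 t = peval (h1 t) x by move=> t; exact: (Hz (Some (inl t))).
have z2E : forall t, z2 t = peval (h2 t) x by move=> t; exact: (Hz (Some (inr t))).
move=> [[g|g]|] /=.
- by apply/gate_holds_map; rewrite E1; move: g; apply/g1.
- by apply/gate_holds_map; rewrite E2; move: g; apply/g2.
- by apply/opE => /=; rewrite e1 e2 v1 // v2 // (Hz None) rE.
Qed.

Lemma polynomial_circuit (I : Type) (p : rpoly R I) :
  exists (T G : finType) gs o h, @computed_by I T G gs o h p.
Proof.
elim: p => [v|c|p IHp q IHq|p IHp q IHq|p IHp].
- exists void, void, (fun g : void => match g with end), (inl v).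
  exists (fun g : void => match g with end) => x z.
  by split=> //; split=> _ [].
- exists unit, unit, (fun=> GConst (inr tt) c), (inr tt), (fun=> PConst I c).
  move=> x z; split=> [|H]; last exact: (H tt).
  by split=> [H []|H []]; exact: (H tt).
- by apply: (computed_by_binary (op := GAdd) (f := +%R)) IHp IHq.
- by apply: (computed_by_binary (op := GMul) (f := *%R)) IHp IHq.
(* Negation is viewed as a binary operation that ignores its second argument, so the circuit of [p]
   is supplied twice. *)
- by apply: (computed_by_binary (op := fun K k i _ => GOpp k i)
    (f := fun a _ => - a) _ _ IHp IHp).
Qed.

End Circuits.

(** * Gate equations as quadratic forms on a simplex *)

Section NormalForm.
Variable R : realType.

Definition linform (m : nat) (l a : 'I_m -> R) : R := \sum_i l i * a i.

Definition bilform (m : nat) (Q : 'I_m -> 'I_m -> R) (a b : 'I_m -> R) : R :=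
  \sum_i \sum_j Q i j * a i * b j.

Lemma bilformB (m : nat) (Q1 Q2 : 'I_m -> 'I_m -> R) a b :
  bilform (fun i j => Q1 i j - Q2 i j) a b = bilform Q1 a b - bilform Q2 a b.
Proof.
rewrite /bilform -sumrB; apply: eq_bigr => i _; rewrite -sumrB.
by apply: eq_bigr => j _; rewrite !mulrBl.
Qed.

Lemma bilform_tensor (m : nat) (l1 l2 : 'I_m -> R) a b :
  bilform (fun i j => l1 i * l2 j) a b = linform l1 a * linform l2 b.
Proof.
rewrite /bilform /linform mulr_suml; apply: eq_bigr => i _; rewrite mulr_sumr.
by apply: eq_bigr => j _; ring.
Qed.

Lemma linform_delta (m : nat) (k : 'I_m) a :
  linform (fun i => (i == k)%:R) a = a k.
Proof.
rewrite /linform (bigD1 k) //= eqxx mul1r big1 ?addr0 // => i /negPf ->.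
by rewrite mul0r.
Qed.

Lemma linformD (m : nat) (l1 l2 : 'I_m -> R) a :
  linform (fun i => l1 i + l2 i) a = linform l1 a + linform l2 a.
Proof. by rewrite /linform -big_split; apply: eq_bigr => i _; rewrite mulrDl. Qed.

Lemma linformZ (m : nat) c (l : 'I_m -> R) a :
  linform (fun i => c * l i) a = c * linform l a.
Proof. by rewrite /linform mulr_sumr; apply: eq_bigr => i _; rewrite mulrA. Qed.

Section GateForms.
Variables (K : finType).
Notation m := #|{: K * bool}|.

(** Index 0 is reserved for the homogenizing coordinate. The two indices of a node hold, up to the
    common scale, the positive numbers whose half difference is the value of the node. *)
Definition pos_index (k : K) : 'I_m.+1 := lift ord0 (enum_rank (k, true)).
Definition neg_index (k : K) : 'I_m.+1 := lift ord0 (enum_rank (k, false)).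

Definition one_form (i : 'I_m.+1) : R := (i == ord0)%:R.
Definition node_form (k : K) (i : 'I_m.+1) : R :=
  2^-1 * (i == pos_index k)%:R + - 2^-1 * (i == neg_index k)%:R.

Lemma linform_one a : linform one_form a = a ord0.
Proof. exact: linform_delta. Qed.

Lemma linform_node k a :
  linform (node_form k) a = (a (pos_index k) - a (neg_index k)) / 2.
Proof.
rewrite linformD (linformZ 2^-1 (fun i => (i == pos_index k)%:R)).
rewrite (linformZ (- 2^-1) (fun i => (i == neg_index k)%:R)) !linform_delta.
by ring.
Qed.

(** Each gate equation is made homogeneous of degree 2: [one_form] stands for the constant 1, and
    linear equations are multiplied by it. The two factors of each product read different arguments,
    so the forms can later be evaluated on two copies of a point. *)
Definition gate_form (g : gate R K) (i j : 'I_m.+1) : R :=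
  match g with
  | GConst k c => (node_form k i + (- c) * one_form i) * one_form j
  | GAdd k a b =>
      (node_form k i + (-1 * node_form a i + -1 * node_form b i)) * one_form j
  | GMul k a b => node_form k i * one_form j - node_form a i * node_form b j
  | GOpp k a => (node_form k i + node_form a i) * one_form j
  end.

Definition hyperbola_form (k : K) (i j : 'I_m.+1) : R :=
  (i == pos_index k)%:R * (j == neg_index k)%:R - one_form i * one_form j.

Lemma bilform_hyperbola k a b :
  bilform (hyperbola_form k) a b =
  a (pos_index k) * b (neg_index k) - a ord0 * b ord0.
Proof.
rewrite bilformB !bilform_tensor !linform_one.
by rewrite !linform_delta.
Qed.

Definition node_value (a : 'I_m.+1 -> R) (k : K) : R :=
  (a (pos_index k) / a ord0 - a (neg_index k) / a ord0) / 2.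

(** On the diagonal, the form equals the square of [a ord0] times the difference of the two sides of
    the gate equation. *)
Lemma bilform_gate g a : a ord0 != 0 ->
  bilform (gate_form g) a a = 0 <-> gate_holds (node_value a) g.
Proof.
move=> a0.
have nodeE k : linform (node_form k) a = node_value a k * a ord0.
  by rewrite linform_node /node_value; field.
have eq0 (u w c : R) : c != 0 -> u = c * w -> (u = 0 <-> w = 0).
  move=> c0 ->; split=> [/eqP|->]; last by rewrite mulr0.
  by rewrite mulf_eq0 (negPf c0) => /eqP.
have eqB (u w : R) : u - w = 0 <-> u = w.
  by split=> [/eqP|->]; rewrite ?subrr // subr_eq0 => /eqP.
have a00 : a ord0 * a ord0 != 0 by rewrite mulf_neq0.
case: g => [k c|k i j|k i j|k i] /=.
- apply: iff_trans (eqB _ _); apply: eq0 a00 _.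
  rewrite bilform_tensor linform_one linformD linformZ linform_one nodeE.
  by ring.
- apply: iff_trans (eqB _ _); apply: eq0 a00 _.
  rewrite bilform_tensor linform_one linformD nodeE linformD !linformZ !nodeE.
  by ring.
- apply: iff_trans (eqB _ _); apply: eq0 a00 _.
  rewrite bilformB !bilform_tensor linform_one !nodeE.
  by ring.
- apply: iff_trans (eqB _ _); apply: eq0 a00 _.
  rewrite bilform_tensor linform_one linformD !nodeE.
  by ring.
Qed.

(** Opposite values at the two indices of a node become reciprocal numbers under [expasinh], as the
    hyperbola equation demands. *)
Definition signed_values (v : K -> R) (j : 'I_m) : R :=
  let: (k, b) := enum_val j in if b then v k else - v k.

Definition simplex_point (v : K -> R) : 'I_m.+1 -> R :=
  simplex_chart (signed_values v).

Lemma simplex_point_pos v k :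
  simplex_point v (pos_index k) = expasinh (v k) * simplex_point v ord0.
Proof. by rewrite /simplex_point simplex_chart_lift /signed_values enum_rankK. Qed.

Lemma simplex_point_neg v k :
  simplex_point v (neg_index k) = expasinh (- v k) * simplex_point v ord0.
Proof. by rewrite /simplex_point simplex_chart_lift /signed_values enum_rankK. Qed.

Lemma simplex_point0_neq0 v : simplex_point v ord0 != 0.
Proof. by rewrite gt_eqF ?simplex_chart_gt0. Qed.

Lemma node_value_simplex_point v k : node_value (simplex_point v) k = v k.
Proof.
rewrite /node_value simplex_point_pos simplex_point_neg.
rewrite !mulfK ?simplex_point0_neq0 // expasinhB.
by field.
Qed.

Lemma bilform_hyperbola_simplex_point v k :
  bilform (hyperbola_form k) (simplex_point v) (simplex_point v) = 0.
Proof.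
rewrite bilform_hyperbola simplex_point_pos simplex_point_neg.
have := expasinhN (v k); move: (expasinh _) (expasinh _) => s t st.
by ring: st.
Qed.

(** After division by [a ord0], the two coordinates of a node are positive with product 1. By
    [expasinh_hyperbola] each is then determined by their half difference, hence so is the whole
    simplex point. *)
Lemma simplex_point_node_value (a : 'I_m.+1 -> R) :
  (forall i, 0 < a i) -> \sum_i a i = 1 ->
  (forall k, bilform (hyperbola_form k) a a = 0) ->
  a = simplex_point (node_value a).
Proof.
move=> a0 a1 hyp; have an0 : a ord0 != 0 by rewrite gt_eqF.
have prod1 k : a (pos_index k) / a ord0 * (a (neg_index k) / a ord0) = 1.
  have := hyp k; rewrite bilform_hyperbola => /eqP; rewrite subr_eq0 => /eqP E.
  by rewrite mulrACA E -invfM divff // mulf_neq0.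
apply: simplex_chart_unique => // j; rewrite /signed_values.
rewrite -{1}(enum_valK j); case: (enum_val j) => k [].
  by rewrite expasinh_hyperbola ?divr_gt0 // divfK.
rewrite /node_value -mulNr opprB expasinh_hyperbola ?divr_gt0 ?divfK //.
by rewrite mulrC.
Qed.

Lemma cvg_simplex_point (T : topologicalType) (v : T -> K -> R) (t : T) i :
  (forall k, v u k @[u --> t] --> v t k) ->
  simplex_point (v u) i @[u --> t] --> simplex_point (v t) i.
Proof.
move=> vt; apply: (@cvg_simplex_chart _ _ _ (fun u => signed_values (v u))) => j.
rewrite /signed_values; case: (enum_val j) => k [] //.
by apply: cvgN; exact: vt.
Qed.

End GateForms.

(** The map [y] embeds the whole affine space in the open simplex, with an inverse given by
    quotients of linear forms, and the forms [Q] cut out exactly the image of [V] there. The bound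
    [0 < m] keeps every simplex coordinate strictly below 1. *)
Lemma variety_normal_form (n : nat) (V : set 'rV[R]_n) :
  real_algebraic_variety V ->
  exists (m : nat) (L : finType) (Q : L -> 'I_m.+1 -> 'I_m.+1 -> R)
         (y : 'rV[R]_n -> 'I_m.+1 -> R) (l : 'I_n -> 'I_m.+1 -> R),
    [/\ forall x i, y x' i @[x' --> x] --> y x i,
        forall x i, 0 < y x i,
        forall x, \sum_i y x i = 1,
        forall (x : 'rV[R]_n) j, x ord0 j = linform (l j) (y x) / y x ord0 &
        (forall x, V x -> forall k, bilform (Q k) (y x) (y x) = 0) /\
        (forall a, (forall i, 0 < a i) -> \sum_i a i = 1 ->
           (forall k, bilform (Q k) a a = 0) ->
           exists2 x, V x & a = y x)] /\ (0 < m)%N.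
Proof.
move=> /variety_hypersurface[p ->].
have [T [G [gs [out [h H]]]]] := polynomial_circuit p.
pose K : finType := ('I_n + T)%type.
(* The extra gate [None] forces the output to be 0, which is the equation [p = 0]. *)
pose gs' (g : option G) : gate R K := if g is Some g then gs g else GConst out 0.
pose Q (k : (option G + K)%type) := match k with
  | inl g => gate_form (gs' g) | inr k => hyperbola_form k end.
pose env (x : 'rV[R]_n) : K -> R :=
  sum_env (coords x) (fun t => peval (h t) (coords x)).
exists #|{: K * bool}|, (option G + K)%type, Q, (fun x => simplex_point (env x)).
exists (fun j => @node_form K (inl j)).
split; last by apply/card_gt0P; exists (out, true).
split.
- move=> x i; apply: (@cvg_simplex_point _ _ env) => -[j|t] /=.
    exact: cvg_coords.
  by apply: (@cvg_peval _ _ _ _ (@coords R n)) => j; exact: cvg_coords.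
- by move=> x i; exact: simplex_chart_gt0.
- by move=> x; exact: simplex_chart_sum.
- move=> x j; rewrite linform_node; have := node_value_simplex_point (env x) (inl j).
  by rewrite /node_value /= /coords => <-; field; rewrite gt_eqF ?simplex_chart_gt0.
split=> [x /= px [g|k]|a a0 a1 aQ] /=.
- apply/bilform_gate; first by rewrite gt_eqF ?simplex_chart_gt0.
  have -> : node_value (simplex_point (env x)) = env x.
    by apply/funext => k; rewrite node_value_simplex_point.
  have [Hg Ho] := H (coords x) (fun t => peval (h t) (coords x)).
  case: g => [g|] /=; first by move: g; apply/Hg.
  by rewrite /env Ho.
- exact: bilform_hyperbola_simplex_point.
have an0 : a ord0 != 0 by rewrite gt_eqF.
have gates g : gate_holds (node_value a) (gs' g).
  by apply/bilform_gate => //; exact: (aQ (inl g)).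
have aE := simplex_point_node_value a0 a1 (fun k => aQ (inr k)).
pose x : 'rV[R]_n := \row_j node_value a (inl j : K).
have xE : coords x = fun j => node_value a (inl j : K).
  by apply/funext => j; rewrite /coords mxE.
have valE : node_value a = sum_env (coords x) (fun t => node_value a (inr t : K)).
  by apply/funext => -[j|t] //=; rewrite xE.
have [Hg Ho] := H (coords x) (fun t => node_value a (inr t : K)).
(* The gates determine every wire from the inputs, so [a] depends on [x] only. *)
have zE : forall t, node_value a (inr t : K) = peval (h t) (coords x).
  by apply/Hg => g; rewrite -valE; exact: (gates (Some g)).
exists x.
  by rewrite /= -Ho // -valE; exact: (gates None).
by rewrite aE; congr simplex_point; rewrite valE /env; congr sum_env; apply/funext.
Qed.

End NormalForm.

(** * Expected payoffs and totally mixed equilibria *)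

Section Games.
Variable R : realType.

Lemma simplex_lt1 (m : nat) (a : 'I_m.+1 -> R) i : (0 < m)%N ->
  (forall i, 0 < a i) -> \sum_i a i = 1 -> a i < 1.
Proof.
move=> m0 a0 a1; have : (1 < #|'I_m.+1|)%N by rewrite card_ord.
rewrite (cardD1 i) inE ltnS => /card_gt0P[j /=]; rewrite !inE andbT => ji.
rewrite -a1 (bigD1 i) //= (bigD1 j) //= ltrDl; apply: ltr_wpDr => //.
by apply: sumr_ge0 => k _; exact/ltW.
Qed.

Section Profiles.
Variables (N : nat) (d : 'I_N -> nat).

(** Distributivity of products over sums, for factors whose index types depend on the player. It is
    proved for [fprod] and carried over by the bijection with dependent finite functions. *)
Lemma sum_profile_prod (F : forall i, 'I_(d i).+1 -> R) :
  \sum_(s : pure_profile d) \prod_i F i (s i) = \prod_i \sum_k F i k.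
Proof.
pose T_ i : finType := 'I_(d i).+1.
rewrite (reindex (@dffun_of_fprod _ T_)); last exact/onW_bij/dffun_of_fprod_bij.
pose P_ i : {ffun T_ i -> R} := [ffun k => F i k].
transitivity (\sum_(t : fprod T_) \prod_(i in 'I_N) P_ i (t i)).
  by apply: eq_bigr => t _; apply: eq_bigr => i _; rewrite !ffunE.
rewrite big_fprod.
transitivity (\prod_i \sum_(j in tagged_with T_ i) untag 0 (P_ i) j).
  by rewrite bigA_distr_big_dep.
apply: eq_bigr => i _; rewrite -(big_tag (fun i => P_ i)).
by apply: eq_bigr => k _; rewrite ffunE.
Qed.

(** Indices are compared as natural numbers, because in a product over players the strategies of
    distinct players live in different ordinal types. *)
Lemma sum_delta_ord (n : nat) (k : 'I_n) (f : 'I_n -> R) :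
  \sum_c (val c == val k)%:R * f c = f k.
Proof.
rewrite (bigD1 k) //= eqxx mul1r big1 ?addr0 // => c ck.
by rewrite (_ : (_ == _ :> nat) = false) ?mul0r //; apply: negPf.
Qed.

(** The probabilities of every player other than [i], [j] and [l] sum to 1 and drop out, leaving the
    expectation over the strategies of [j] and [l]. *)
Lemma sum_profile_pair (sigma : forall i, 'I_(d i).+1 -> R) (i j l : 'I_N)
    (k : 'I_(d i).+1) (M : 'I_(d j).+1 -> 'I_(d l).+1 -> R) :
  (forall p, \sum_c sigma p c = 1) -> j != i -> l != i -> l != j ->
  \sum_(s : pure_profile d | s i == k)
     M (s j) (s l) * \prod_(p | p != i) sigma p (s p) =
  \sum_a \sum_b M a b * sigma j a * sigma l b.
Proof.
move=> sigma1 ji li lj.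
pose ind a b p (c : nat) : R :=
  if p == j then (c == a)%:R else if p == l then (c == b)%:R else 1.
pose F (a : 'I_(d j).+1) (b : 'I_(d l).+1) p (c : 'I_(d p).+1) : R :=
  if p == i then (val c == val k)%:R else ind (val a) (val b) p (val c) * sigma p c.
have indE a b (s : pure_profile d) :
    \prod_(p | p != i) ind a b p (val (s p)) =
    (val (s j) == a)%:R * (val (s l) == b)%:R.
  rewrite (bigD1 j) //= (bigD1 l) /= ?li ?lj //.
  rewrite big1 ?mulr1 => [|p /andP[/andP[_ pj] pl]].
    by rewrite /ind eqxx (negPf lj) eqxx.
  by rewrite /ind (negPf pj) (negPf pl).
have prodF a b (s : pure_profile d) : \prod_p F a b p (s p) =
    (s i == k)%:R * ((val (s j) == val a)%:R * (val (s l) == val b)%:R *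
      \prod_(p | p != i) sigma p (s p)).
  rewrite (bigD1 i) //= {1}/F eqxx; congr (_ * _).
  rewrite -indE -big_split; apply: eq_bigr => p /negPf pi.
  by rewrite /F pi.
have sumF a b : \prod_p \sum_c F a b p c = sigma j a * sigma l b.
  rewrite (bigD1 i) //= (bigD1 j) //= (bigD1 l) /= ?li ?lj //.
  rewrite [X in _ * (_ * (_ * X))]big1 ?mulr1 => [|p /andP[/andP[pi pj] pl]].
    rewrite /F eqxx (negPf ji) (negPf li) /ind eqxx (negPf lj) eqxx.
    have -> : \sum_(c < (d i).+1) (val c == val k)%:R = 1 :> R.
      rewrite -[RHS](sum_delta_ord k (fun=> 1)).
      by apply: eq_bigr => c _; rewrite mulr1.
    by rewrite !sum_delta_ord mul1r.
  rewrite -(sigma1 p); apply: eq_bigr => c _.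
  by rewrite /F (negPf pi) /ind (negPf pj) (negPf pl) mul1r.
(* Expanding [M (s j) (s l)] over indicator functions of the values [a] and [b] leaves inner sums of
   products over players, to which [sum_profile_prod] applies. *)
transitivity (\sum_a \sum_b M a b * \sum_(s : pure_profile d) \prod_p F a b p (s p)).
  under [RHS]eq_bigr do under eq_bigr do rewrite mulr_sumr.
  under [RHS]eq_bigr do rewrite exchange_big.
  rewrite [RHS]exchange_big big_mkcond; apply: eq_bigr => s _ /=.
  transitivity ((s i == k)%:R * (M (s j) (s l) * \prod_(p | p != i) sigma p (s p))).
    by case: eqP; rewrite ?mul1r ?mul0r.
  rewrite -(sum_delta_ord (s j) (fun a => (s i == k)%:R *
    (M a (s l) * \prod_(p | p != i) sigma p (s p)))).
  apply: eq_bigr => a _.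
  rewrite -(sum_delta_ord (s l) (fun b => (val a == val (s j))%:R *
    ((s i == k)%:R * (M a b * \prod_(p | p != i) sigma p (s p))))).
  apply: eq_bigr => b _; rewrite prodF (eq_sym (val a)) (eq_sym (val b)).
  by ring.
by apply: eq_bigr => a _; apply: eq_bigr => b _; rewrite sum_profile_prod sumF mulrA.
Qed.

Lemma dev_payoff_pairwise (T : finType) (u : 'I_N -> pure_profile d -> R)
    (sigma : forall i, 'I_(d i).+1 -> R) (i : 'I_N) (j l : T -> 'I_N)
    (M : forall t, 'I_(d i).+1 -> 'I_(d (j t)).+1 -> 'I_(d (l t)).+1 -> R) k :
  (forall p, \sum_c sigma p c = 1) ->
  (forall t, [/\ j t != i, l t != i & l t != j t]) ->
  (forall s, u i s = \sum_t M t (s i) (s (j t)) (s (l t))) ->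
  dev_payoff u sigma k =
  \sum_t \sum_a \sum_b M t k a b * sigma (j t) a * sigma (l t) b.
Proof.
move=> sigma1 neq uE; rewrite /dev_payoff.
under eq_bigr => s /eqP sk do rewrite uE sk mulr_suml.
rewrite exchange_big; apply: eq_bigr => t _.
by have [ji li lj] := neq t; exact: sum_profile_pair.
Qed.

Lemma dev_payoff0 (u : 'I_N -> pure_profile d -> R)
    (sigma : forall i, 'I_(d i).+1 -> R) (i : 'I_N) (k : 'I_(d i).+1) :
  (forall s, u i s = 0) -> dev_payoff u sigma k = 0.
Proof. by move=> u0; rewrite /dev_payoff big1 // => s _; rewrite u0 mul0r. Qed.

Notation C := (coord_index d).
Notation pt i j := (existT (fun i0 : 'I_N => 'I_(d i0)) i j : C).

Lemma profile_of_lift (x : 'rV[R]_#|C|) i j :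
  profile_of x (lift ord0 j) = x ord0 (enum_rank (pt i j)).
Proof. by rewrite /profile_of liftK. Qed.

Lemma profile_of0 (x : 'rV[R]_#|C|) i :
  profile_of x (ord0 : 'I_(d i).+1) = 1 - \sum_j x ord0 (enum_rank (pt i j)).
Proof. by rewrite /profile_of unlift_none. Qed.

Lemma profile_of_sum (x : 'rV[R]_#|C|) i :
  \sum_(j : 'I_(d i).+1) profile_of x j = 1.
Proof.
rewrite big_ord_recl profile_of0; under [X in _ + X]eq_bigr do rewrite profile_of_lift.
by rewrite subrK.
Qed.

Definition point_of (s : forall i, 'I_(d i).+1 -> R) : 'rV[R]_#|C| :=
  \row_c s (tag (enum_val c)) (lift ord0 (tagged (enum_val c))).

Lemma point_ofK (s : forall i, 'I_(d i).+1 -> R) i j :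
  \sum_j s i j = 1 -> profile_of (point_of s) j = s i j.
Proof.
have cE j' : point_of s ord0 (enum_rank (pt i j')) = s i (lift ord0 j').
  by rewrite mxE enum_rankK.
move=> s1; case: (unliftP ord0 j) => [j' ->|->]; first by rewrite profile_of_lift.
rewrite profile_of0; under eq_bigr do rewrite cE.
by move: s1; rewrite big_ord_recl => <-; rewrite addrK.
Qed.

Lemma profile_of_inj (x y : 'rV[R]_#|C|) :
  (forall i (j : 'I_(d i).+1), profile_of x j = profile_of y j) -> x = y.
Proof.
move=> xy; apply/rowP => c; have := xy (tag (enum_val c)) (lift ord0 (tagged (enum_val c))).
rewrite !profile_of_lift.
suff -> : enum_rank (pt (tag (enum_val c)) (tagged (enum_val c))) = c by [].
by rewrite -[RHS]enum_valK; congr enum_rank; case: (enum_val c).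
Qed.

Definition profile_poly i (j : 'I_(d i).+1) : rpoly R 'I_#|C| :=
  if unlift ord0 j is Some j' then PVar R (enum_rank (pt i j'))
  else PAdd (PConst _ 1) (POpp (rpoly_sum predT (fun j' => PVar R (enum_rank (pt i j'))))).

Lemma peval_profile_poly i (j : 'I_(d i).+1) x :
  peval (profile_poly j) (coords x) = profile_of x j.
Proof.
rewrite /profile_poly /profile_of; case: (unlift _ _) => //=.
by rewrite peval_sum.
Qed.

(** With at least two strategies per player, positivity and total mass 1 already give the upper
    bound 1. *)
Lemma totally_mixed_NEP (u : 'I_N -> pure_profile d -> R) x :
  (forall i, 0 < d i)%N ->
  totally_mixed_NE u x <->
  (forall i (j : 'I_(d i).+1), 0 < profile_of x j) /\
  (forall i (j : 'I_(d i).+1),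
     dev_payoff u (profile_of x) j = dev_payoff u (profile_of x) (ord0 : 'I_(d i).+1)).
Proof.
move=> d0; split=> [[p e]|[p e]]; split=> // i j; first by have /andP[] := p i j.
rewrite p /=; apply: (simplex_lt1 _ (d0 i)); [exact: p|exact: profile_of_sum].
Qed.

Lemma totally_mixed_NE_semialgebraic (u : 'I_N -> pure_profile d -> R) :
  semialgebraic (totally_mixed_NE u).
Proof.
pose dev i (k : 'I_(d i).+1) : rpoly R 'I_#|C| :=
  rpoly_sum (fun s : pure_profile d => s i == k) (fun s => PMul (PConst _ (u i s))
    (rpoly_prod (fun j => j != i) (fun j => profile_poly (s j)))).
have devE i (k : 'I_(d i).+1) x :
    peval (dev i k) (coords x) = dev_payoff u (profile_of x) k.
  rewrite peval_sum; apply: eq_bigr => s _ /=; rewrite peval_prod; congr (_ * _).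
  by apply: eq_bigr => j _; rewrite peval_profile_poly.
pose phi i (j : 'I_(d i).+1) := FAnd (FGt0 (profile_poly j)) (FAnd
  (FGt0 (PAdd (PConst _ 1) (POpp (profile_poly j))))
  (FEq0 (PAdd (dev i j) (POpp (dev i ord0))))).
exists (saformula_all (fun i => saformula_all (phi i))).
apply/seteqP; split=> x /= H.
  case: H => p e; apply/fholds_all => i; apply/fholds_all => j /=.
  rewrite !devE !peval_profile_poly subr_gt0 e subrr.
  by have /andP[] := p i j.
have {}H i (j : 'I_(d i).+1) : fholds (phi i j) (coords x).
  by have /fholds_all := H; move=> /(_ i) /fholds_all /(_ j).
split=> i j; have := H i j; rewrite /= !devE !peval_profile_poly subr_gt0.
  by case=> -> [-> _].
by case=> _ [_ /eqP]; rewrite subr_eq0 => /eqP.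
Qed.

End Profiles.
End Games.

(** * Games whose equilibria are a variety times free simplices *)

Section FreePlayers.
Variables (R : realType) (N : nat) (d : 'I_N -> nat).
Variables (u : 'I_N -> pure_profile d -> R) (n : nat) (V : set 'rV[R]_n).
Variables (free : pred 'I_N) (s : 'rV[R]_n -> forall i, 'I_(d i).+1 -> R).
Notation C := (coord_index d).
Variables (num den : 'I_n -> rpoly R 'I_#|C|).

(** The players outside [free] encode the point [x] through the prescribed strategies [s x]; the
    free players may use any totally mixed strategy. *)
Definition bound_profile (x : 'rV[R]_n) (z : 'rV[R]_#|C|) : Prop :=
  (forall i (j : 'I_(d i).+1), 0 < profile_of z j) /\
  (forall i, ~~ free i -> forall j : 'I_(d i).+1, profile_of z j = s x j).

Hypothesis V_semialgebraic : semialgebraic V.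
Hypothesis s_cvg : forall x i (j : 'I_(d i).+1), s x' j @[x' --> x] --> s x j.
Hypothesis s_gt0 : forall x i (j : 'I_(d i).+1), ~~ free i -> 0 < s x j.
Hypothesis s_sum :
  forall x i, ~~ free i -> \sum_(j : 'I_(d i).+1) s x j = 1.
Hypothesis NE_bound :
  forall z, totally_mixed_NE u z <-> exists2 x, V x & bound_profile x z.
Hypothesis recover : forall x z, V x -> bound_profile x z -> forall k,
  peval (den k) (coords z) != 0 /\
  x ord0 k = peval (num k) (coords z) / peval (den k) (coords z).

Notation free_coord := {c : C | free (tag c)}.
Notation K := #|{: free_coord}|.

(** The first [n] coordinates recover the point of [V]. Each remaining one is the rational inverse
    of the simplex chart, taken from the ratio of a free strategy to strategy 0 of the same
    player. *)
Let stable_num (k : 'I_(n + K)) : rpoly R 'I_#|C| :=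
  match fintype.split k with
  | inl k => num k
  | inr f => let c := val (enum_val f) in
      let p := profile_poly R (lift ord0 (tagged c)) in
      let p0 := profile_poly R (ord0 : 'I_(d (tag c)).+1) in
      PAdd (PMul p p) (POpp (PMul p0 p0))
  end.

Let stable_den (k : 'I_(n + K)) : rpoly R 'I_#|C| :=
  match fintype.split k with
  | inl k => den k
  | inr f => let c := val (enum_val f) in
      let p := profile_poly R (lift ord0 (tagged c)) in
      let p0 := profile_poly R (ord0 : 'I_(d (tag c)).+1) in
      PMul (PConst _ 2) (PMul p p0)
  end.

Let to_stable := rational_map stable_num stable_den.

(** The default 0 is never read by [full_profile], which consults [free_value] only for free
    players. *)
Let free_value (w : 'rV[R]_K) (c : C) : R :=
  if insub c is Some c' then w ord0 (enum_rank (c' : free_coord)) else 0.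

Let full_profile (z : 'rV[R]_(n + K)) i (j : 'I_(d i).+1) : R :=
  if free i then simplex_chart (fun j' => free_value (rsubmx z)
    (existT (fun i0 : 'I_N => 'I_(d i0)) i j')) j
  else s (lsubmx z) j.

Let of_stable (z : 'rV[R]_(n + K)) : 'rV[R]_#|C| := point_of (@full_profile z).

Let full_profile_sum z i : \sum_j @full_profile z i j = 1.
Proof.
rewrite /full_profile; case: (boolP (free i)) => fi; last exact: s_sum.
exact: simplex_chart_sum.
Qed.

Let profile_of_stable z i (j : 'I_(d i).+1) :
  profile_of (of_stable z) j = full_profile z j.
Proof. by apply: point_ofK; exact: full_profile_sum. Qed.

Let bound_of_stable z : bound_profile (lsubmx z) (of_stable z).
Proof.
split=> [i j|i fi j]; rewrite profile_of_stable /full_profile; last first.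
  by rewrite (negPf fi).
by case: (boolP (free i)) => fi; [exact: simplex_chart_gt0|exact: s_gt0].
Qed.

Let lsubmx_to_stable x z : V x -> bound_profile x z -> lsubmx (to_stable z) = x.
Proof.
move=> Vx xz; apply/rowP => k; have [_ ->] := recover Vx xz k.
by rewrite !mxE /stable_num /stable_den (unsplitK (inl k)).
Qed.

Let to_stableE z f : let c := val (enum_val f) in
  to_stable z ord0 (rshift n f) =
  (profile_of z (lift ord0 (tagged c)) ^+ 2 -
   profile_of z (ord0 : 'I_(d (tag c)).+1) ^+ 2) /
  (2 * (profile_of z (lift ord0 (tagged c)) *
        profile_of z (ord0 : 'I_(d (tag c)).+1))).
Proof.
rewrite mxE /stable_num /stable_den (unsplitK (inr f)) /=.
by rewrite !peval_profile_poly.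
Qed.

Let stable_den_neq0 z k : totally_mixed_NE u z ->
  peval (stable_den k) (coords z) != 0.
Proof.
move=> /NE_bound[x Vx xz]; rewrite /stable_den.
case: (fintype.split k) => [k'|f] /=; first by have [] := recover Vx xz k'.
by rewrite !peval_profile_poly !mulf_neq0 // gt_eqF ?xz.1.
Qed.

(** Bound players give the point of [V] and the charts of the free players give a Euclidean factor.
    The equilibrium set is thus isomorphic to a product with [V], and the canonical projection
    removes the other factor. *)
Lemma free_players_stably_isomorphic :
  stably_isomorphic (RSet (totally_mixed_NE u)) (RSet V).
Proof.
have fvE z i (fi : free i) (j : 'I_(d i)) :
    let c := existT (fun i0 : 'I_N => 'I_(d i0)) i j : C in
    free_value z c = z ord0 (enum_rank (Sub c fi : free_coord)).
  by rewrite /free_value insubT.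
have to_stableK : {in totally_mixed_NE u, cancel to_stable of_stable}.
  move=> z /set_mem /NE_bound[x Vx xz]; apply: profile_of_inj => i j.
  rewrite profile_of_stable /full_profile (lsubmx_to_stable Vx xz).
  case: (boolP (free i)) => fi; last by rewrite xz.2.
  apply/esym; congr (_ j); apply: simplex_chart_unique.
    exact: profile_of_sum.
  move=> j'; rewrite (fvE _ _ fi) [rsubmx _ _ _]mxE to_stableE enum_rankK /=.
  by rewrite expasinh_ratio // xz.1.
have of_stableK : {in @times_Rk R n K V, cancel of_stable to_stable}.
  move=> z /set_mem [x Vx [w _ <-]]; have := bound_of_stable (row_mx x w).
  rewrite row_mxKl => xz; rewrite -[LHS]hsubmxK (lsubmx_to_stable Vx xz).
  congr row_mx; apply/rowP => f; rewrite [LHS]mxE to_stableE !profile_of_stable.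
  rewrite /full_profile (valP (enum_val f)) row_mxKr simplex_chart_lift.
  have -> : free_value w (existT (fun i0 : 'I_N => 'I_(d i0)) (tag (val (enum_val f)))
      (tagged (val (enum_val f)))) = w ord0 f.
    rewrite (fvE _ _ (valP (enum_val f))); congr (w _ _).
    rewrite -[RHS]enum_valK; congr enum_rank; apply: val_inj => /=.
    by case: (val (enum_val f)).
  by rewrite ratio_expasinh // gt_eqF ?simplex_chart_gt0.
apply: stiso_trans (@stiso_proj R n K V V_semialgebraic).
apply: stiso_iso.
- exact: totally_mixed_NE_semialgebraic.
- exact: semialgebraic_times.
exists to_stable, of_stable; split; split => //.
- move=> _ [z /NE_bound[x Vx xz] <-]; exists x => //.
  exists (rsubmx (to_stable z)) => //.
  by rewrite -[RHS]hsubmxK (lsubmx_to_stable Vx xz).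
- move=> _ [_ [x Vx [w _ <-]] <-]; apply/NE_bound; exists x => //.
  by have := bound_of_stable (row_mx x w); rewrite row_mxKl.
- by apply: rational_map_continuous => z k; exact: stable_den_neq0.
(* The inverse is continuous on the whole product space: bound coordinates through [s], free ones
   through the chart. *)
- apply: continuous_in_subspaceT => z _; apply: cvg_row => c.
  pose fp (y : 'rV[R]_(n + K)) := full_profile y (lift ord0 (tagged (enum_val c))).
  have -> : (fun y => of_stable y ord0 c) = fp by apply/funext => y; rewrite mxE.
  rewrite [X in _ --> X]mxE /fp /full_profile; case: (boolP (free _)) => fc; last first.
    apply: (@cvg_comp _ _ _ lsubmx (fun x => s x _) _ _ _
      (@continuous_lsubmx _ _ _ _ z)); exact: s_cvg.
  apply: (@cvg_simplex_chart _ _ _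
    (fun y j' => free_value (rsubmx y) (existT _ _ j'))) => j.
  pose cj : C := existT (fun i0 : 'I_N => 'I_(d i0)) _ j.
  pose fj (y : 'rV[R]_(n + K)) := free_value (rsubmx y) cj.
  rewrite -[X in X @ _]/fj -[X in _ --> X]/(fj z).
  have -> : fj = (fun w : 'rV[R]_K => w ord0 (enum_rank (Sub cj fc))) \o rsubmx.
    by apply/funext => y; rewrite /fj (fvE _ _ fc).
  apply: (@cvg_comp _ _ _ rsubmx (fun w : 'rV[R]_K => w ord0 _) _ _ _
    (@continuous_rsubmx _ _ _ _ z)); exact: coord_continuous.
- apply: rational_map_graph; first exact: totally_mixed_NE_semialgebraic.
  by move=> z k; exact: stable_den_neq0.
Qed.

End FreePlayers.

(** * The two games *)

Section Universality.
Variables (R : realType) (n : nat) (V : set 'rV[R]_n).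
Hypothesis V_variety : real_algebraic_variety V.

(** The equation [a i = b i] made bilinear: since both points have total mass 1, the constant 1
    stands for the sum of the coordinates of the other point. *)
Definition copy_form (m : nat) (i a b : 'I_m) : R :=
  (a == i)%:R * 1 - 1 * (b == i)%:R.

Lemma bilform_copy (m : nat) (i : 'I_m) (a b : 'I_m -> R) :
  \sum_j a j = 1 -> \sum_j b j = 1 -> bilform (copy_form i) a b = a i - b i.
Proof.
move=> a1 b1; rewrite /copy_form.
rewrite (bilformB (fun a b => (a == i)%:R * 1) (fun a b => 1 * (b == i)%:R)).
rewrite (bilform_tensor (fun a => (a == i)%:R) (fun=> 1)).
rewrite (bilform_tensor (fun=> 1) (fun b => (b == i)%:R)) !linform_delta /linform.
under eq_bigr do rewrite mul1r.
by under [X in _ - X * _]eq_bigr do rewrite mul1r; rewrite a1 b1 mulr1 mul1r.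
Qed.

(* Players 0 and 1 are indifferent and choose points of the simplex; each pure
   strategy of player 2 beyond the first imposes one bilinear equation. *)
Lemma three_player_game :
  exists (d : 'I_3 -> nat) (u : 'I_3 -> pure_profile d -> R),
    stably_isomorphic (RSet (totally_mixed_NE u)) (RSet V).
Proof.
have [m [L [Q [y [l [[y_cvg y_gt0 y_sum yE [VQ QV]] m_gt0]]]]]] :=
  variety_normal_form V_variety.
pose E : finType := ('I_m.+1 + L)%type.
pose form (e : E) := match e with inl i => copy_form i | inr k => Q k end.
pose d (i : 'I_3) := if i == 2 :> nat then #|E| else m.
pose p0 : 'I_3 := Ordinal (isT : (0 < 3)%N).
pose p1 : 'I_3 := Ordinal (isT : (1 < 3)%N).
pose p2 : 'I_3 := Ordinal (isT : (2 < 3)%N).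
(* The first strategy of player 2 always pays 0, so indifference with it makes each form vanish. *)
pose payoff (k : 'I_#|E|.+1) (a b : 'I_m.+1) : R :=
  if unlift ord0 k is Some e then form (enum_val e) a b else 0.
pose u (i : 'I_3) (s : pure_profile d) : R :=
  if i == 2 :> nat then payoff (s p2) (s p0) (s p1) else 0.
exists d, u.
have d_gt0 i : (0 < d i)%N.
  rewrite /d; case: ifP => // _.
  by apply/card_gt0P; exists (inl ord0).
have devE z (k : 'I_#|E|.+1) : dev_payoff u (profile_of z) (k : 'I_(d p2).+1) =
    if unlift ord0 k is Some e then
      bilform (form (enum_val e)) (@profile_of _ _ _ z p0) (@profile_of _ _ _ z p1)
    else 0.
  rewrite (@dev_payoff_pairwise _ _ _ unit _ _ p2 (fun=> p0) (fun=> p1)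
    (fun _ => payoff)) //; last 2 first.
  - by move=> p; exact: profile_of_sum.
  - by move=> s; rewrite (big_pred1 tt) // => -[].
  rewrite (big_pred1 tt) => [|[]] //; rewrite /payoff.
  case: (unlift _ _) => [e|]; first by [].
  by rewrite big1 // => a _; rewrite big1 // => b _; rewrite !mul0r.
(* For a variable player the type of [j] is not literally ['I_m.+1]; [inord] casts it, and is the
   identity for players 0 and 1. *)
pose s (x : 'rV[R]_n) i (j : 'I_(d i).+1) := y x (inord j).
have boundE x (w : forall i, 'I_(d i).+1 -> R) :
    (forall i : 'I_3, (i != 2 :> nat) -> forall j, w i j = s x i j) <->
    (w p0 = y x :> ('I_m.+1 -> R)) /\ (w p1 = y x :> ('I_m.+1 -> R)).
  split=> [wE|[w0 w1] i i2].
    by split; apply/funext => j; rewrite wE // /s inord_val.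
  have [i0|i1] : i = p0 \/ i = p1.
    by case: i i2 => -[|[|[|i]]] // lti _; [left|right]; exact: val_inj.
  - by rewrite i0 => j; rewrite w0 /s (inord_val (j : 'I_m.+1)).
  - by rewrite i1 => j; rewrite w1 /s (inord_val (j : 'I_m.+1)).
(* By [yE] the point [x] can be read off from player 0, whose strategy is [y x]. *)
pose num (k : 'I_n) := rpoly_sum predT (fun i : 'I_m.+1 =>
  PMul (PConst _ (l k i)) (profile_poly R (i : 'I_(d p0).+1))).
pose den (k : 'I_n) := profile_poly R (ord0 : 'I_(d p0).+1).
apply: (@free_players_stably_isomorphic _ _ _ _ _ _
  (fun i : 'I_3 => i == 2 :> nat) s num den).
- exact: variety_semialgebraic.
- by move=> x i j; exact: y_cvg.
- by move=> x i j _; exact: y_gt0.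
- move=> x i /negPf i2; rewrite -(y_sum x) /s; have dE : d i = m by rewrite /d i2.
  by move: (d i) dE => _ ->; apply: eq_bigr => j _; rewrite inord_val.
- move=> z; split.
    move=> /(totally_mixed_NEP _ _ d_gt0) [z_gt0 z_eq].
    pose a : 'I_m.+1 -> R := @profile_of _ _ _ z p0.
    pose b : 'I_m.+1 -> R := @profile_of _ _ _ z p1.
    have a1 : \sum_i a i = 1 by exact: (profile_of_sum z p0).
    have b1 : \sum_i b i = 1 by exact: (profile_of_sum z p1).
    have eqs e : bilform (form e) a b = 0.
      have := z_eq p2 (lift ord0 (enum_rank e)); rewrite !devE liftK unlift_none.
      by rewrite enum_rankK.
    (* The copy equations identify the two simplex points, which turns the bilinear equations into
       the quadratic ones of the normal form. *)
    have ab : b = a.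
      apply/funext => i; have := eqs (inl i); rewrite /= bilform_copy // => /eqP.
      by rewrite subr_eq0 => /eqP.
    have [x Vx ax] : exists2 x, V x & a = y x.
      apply: QV => // [i|k]; first exact: z_gt0.
      by have := eqs (inr k); rewrite /= ab.
    exists x => //; split=> //; apply/boundE.
    by split; [exact: ax|exact: etrans ab ax].
  move=> [x Vx [z_gt0 /boundE[z0 z1]]].
  apply/(totally_mixed_NEP _ _ d_gt0); split=> // i j.
  have [i2|i2] := boolP (i == 2 :> nat); last first.
    by rewrite !dev_payoff0 // => t; rewrite /u (negPf i2).
  have ip : i = p2 by exact/val_inj/eqP.
  move: j; rewrite ip => j; rewrite !devE unlift_none z0 z1.
  case: (unlift _ _) => // e; case: (enum_val e) => [i'|k] /=; last exact: VQ.
  by rewrite bilform_copy // subrr.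
- move=> x z Vx [z_gt0 /boundE[z0 z1]] k; rewrite peval_profile_poly.
  split; first by rewrite gt_eqF.
  rewrite yE peval_sum /linform; congr (_ / _); last by rewrite z0.
  by apply: eq_bigr => i _ /=; rewrite peval_profile_poly z0.
Qed.

(** An equation is split into contributions of pairs of players, one from each family. For [None],
    the equation stating that the coordinates sum to 1, the constant is spread evenly over the
    [m.+1] pairs with [j = ord0]; a copy equation uses a single diagonal pair. *)
Definition binary_term (m : nat) (L : finType) (Q : L -> 'I_m.+1 -> 'I_m.+1 -> R)
  (e : option ('I_m.+1 + L)) (i j : 'I_m.+1) (a b : R) : R :=
  match e with
  | None => (j == ord0)%:R * (a - m.+1%:R^-1)
  | Some (inl i0) => (i == i0)%:R * ((j == i0)%:R * (a - b))
  | Some (inr k) => Q k i j * a * b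
  end.

Lemma binary_term_sum m L Q e (a b : 'I_m.+1 -> R) :
  \sum_(t : 'I_m.+1 * 'I_m.+1) @binary_term m L Q e t.1 t.2 (a t.1) (b t.2) =
  match e with
  | None => \sum_i a i - 1
  | Some (inl i0) => a i0 - b i0
  | Some (inr k) => bilform (Q k) a b
  end.
Proof.
rewrite -(pair_bigA _ (fun i j => binary_term Q e i j (a i) (b j))) /=.
case: e => [[i0|k]|] //=.
  rewrite (bigD1 i0) //= (bigD1 i0) //= eqxx !mul1r big1 => [|j /negPf ->]; last first.
    by rewrite mul0r mulr0.
  rewrite big1 ?addr0 // => i /negPf ->; rewrite big1 // => j _.
  by rewrite mul0r.
transitivity (\sum_i (a i - m.+1%:R^-1)).
  apply: eq_bigr => i _; rewrite (bigD1 ord0) // eqxx mul1r big1 /= ?addr0 //.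
  by move=> j /negPf ->; rewrite mul0r.
by rewrite sumrB sumr_const card_ord -[X in _ - X]mulr_natr mulVf.
Qed.

(** The term is affine in [a] and in [b] separately, so its expectation over independent choices of
    0 or 1 is its value at the probabilities of 1. *)
Lemma binary_term_expectation m L Q e i j (a b : 'I_2 -> R) :
  \sum_k a k = 1 -> \sum_k b k = 1 ->
  \sum_(k < 2) \sum_(k' < 2) @binary_term m L Q e i j k%:R k'%:R * a k * b k' =
  binary_term Q e i j (a ord_max) (b ord_max).
Proof.
rewrite !big_ord_recl !big_ord0 !addr0.
have -> : lift ord0 ord0 = ord_max :> 'I_2 by exact: val_inj.
move: (a ord0) (a ord_max) (b ord0) (b ord_max) => a0 a1 b0 b1 a_sum b_sum.
have -> : a0 = 1 - a1 by rewrite -a_sum addrK.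
have -> : b0 = 1 - b1 by rewrite -b_sum addrK.
by case: e => [[i0|k]|] /=; ring.
Qed.

(* The simplex coordinates are the probabilities of the second strategies of
   two families of indifferent players; one further player per equation. *)
Lemma binary_game :
  exists (N : nat) (d : 'I_N -> nat) (u : 'I_N -> pure_profile d -> R),
    (forall i : 'I_N, d i = 1%N) /\
    stably_isomorphic (RSet (totally_mixed_NE u)) (RSet V).
Proof.
have [m [L [Q [y [l [[y_cvg y_gt0 y_sum yE [VQ QV]] m_gt0]]]]]] :=
  variety_normal_form V_variety.
pose E : finType := option ('I_m.+1 + L)%type.
(* Two families of players carry the two copies of the simplex point, and a third has one player per
   equation. *)
pose P : finType := ('I_m.+1 + 'I_m.+1 + E)%type.
pose d (_ : 'I_#|P|) := 1%N.
pose pa (i : 'I_m.+1) : 'I_#|P| := enum_rank (inl (inl i) : P).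
pose pb (i : 'I_m.+1) : 'I_#|P| := enum_rank (inl (inr i) : P).
pose pe (e : E) : 'I_#|P| := enum_rank (inr e : P).
pose free (p : 'I_#|P|) := if enum_val p is inr _ then true else false.
pose payoff (e : E) (t : 'I_m.+1 * 'I_m.+1) (k a b : 'I_2) : R :=
  if k == ord0 then 0 else binary_term Q e t.1 t.2 a%:R b%:R.
pose u (p : 'I_#|P|) (s : pure_profile d) : R :=
  if enum_val p is inr e then
    \sum_t payoff e t (s p) (s (pa t.1)) (s (pb t.2)) else 0.
exists #|P|, d, u; split=> //.
pose prob (z : 'rV[R]_#|coord_index d|) (p : 'I_#|P|) : R :=
  @profile_of _ _ _ z p ord_max.
have pairP (w : 'I_2 -> R) : \sum_k w k = w ord0 + w ord_max.
  by rewrite !big_ord_recl big_ord0 addr0; congr (_ + w _); exact: val_inj.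
have devE z e (k : 'I_2) : dev_payoff u (profile_of z) (k : 'I_(d (pe e)).+1) =
    if k == ord0 then 0 else
      \sum_(t : 'I_m.+1 * 'I_m.+1)
        binary_term Q e t.1 t.2 (prob z (pa t.1)) (prob z (pb t.2)).
  rewrite (@dev_payoff_pairwise _ _ _ _ _ _ (pe e) (fun t => pa t.1)
    (fun t => pb t.2) (payoff e)); last 3 first.
  - by move=> p; exact: profile_of_sum.
  - by move=> t; split; rewrite (inj_eq enum_rank_inj).
  - by move=> s; rewrite /u enum_rankK.
  rewrite /payoff; case: ifP => _.
    rewrite big1 // => t _; rewrite big1 // => a _; rewrite big1 // => b _.
    by rewrite !mul0r.
  apply: eq_bigr => t _; apply: binary_term_expectation; exact: profile_of_sum.
(* The value at equation players is arbitrary, since these are free. *)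
pose ix (p : 'I_#|P|) : 'I_m.+1 := match enum_val p with
  | inl (inl i) | inl (inr i) => i | inr _ => ord0 end.
pose s (x : 'rV[R]_n) (p : 'I_#|P|) (j : 'I_(d p).+1) : R :=
  if j == ord0 then 1 - y x (ix p) else y x (ix p).
have boundE x z :
    (forall p, ~~ free p -> forall j : 'I_(d p).+1, profile_of z j = s x p j) <->
    (forall i, prob z (pa i) = y x i /\ prob z (pb i) = y x i).
  split=> [zE i|zE p].
    by rewrite /prob !zE /free /s /ix ?enum_rankK.
  have zs (i : 'I_m.+1) q (j : 'I_2) : prob z q = y x i ->
      profile_of z (j : 'I_(d q).+1) = if j == ord0 then 1 - y x i else y x i.
    move=> <-; have := profile_of_sum z q; rewrite pairP /prob => z1.
    case: (unliftP ord0 j) => [j' ->|->]; last by rewrite eqxx -z1 addrK.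
    by congr profile_of; apply: val_inj; rewrite /= (ord1 j').
  rewrite -(enum_valK p); move: (enum_val p) => q.
  rewrite /free /s /ix enum_rankK; case: q => [[i|i]|e] //= _ j.
    exact: zs (zE i).1.
  exact: zs (zE i).2.
pose num (k : 'I_n) := rpoly_sum predT (fun i : 'I_m.+1 =>
  PMul (PConst _ (l k i)) (profile_poly R (ord_max : 'I_(d (pa i)).+1))).
pose den (k : 'I_n) := profile_poly R (ord_max : 'I_(d (pa ord0)).+1).
apply: (@free_players_stably_isomorphic _ _ _ _ _ _ free s num den).
- exact: variety_semialgebraic.
- move=> x p j; rewrite /s; case: (j == ord0); last exact: y_cvg.
  by apply: (@cvg_onem _ _ (fun x' => y x' _)); exact: y_cvg.
(* The first strategy has probability [1 - y x _], which is positive because simplex coordinates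
   stay below 1. *)
- move=> x p j _; rewrite /s; case: ifP => _; last exact: y_gt0.
  by rewrite subr_gt0 (simplex_lt1 _ m_gt0).
- by move=> x p _; rewrite pairP /s /= subrK.
- move=> z; split.
    move=> /totally_mixed_NEP [] // z_gt0 z_eq.
    pose a i := prob z (pa i); pose b i := prob z (pb i).
    have eqs e : \sum_(t : 'I_m.+1 * 'I_m.+1)
        binary_term Q e t.1 t.2 (a t.1) (b t.2) = 0.
      by have := z_eq (pe e) ord_max; rewrite !devE.
    have ab : b = a.
      apply/funext => i; have := eqs (Some (inl i)); rewrite binary_term_sum => /eqP.
      by rewrite subr_eq0 => /eqP.
    have [x Vx ax] : exists2 x, V x & a = y x.
      apply: QV => [i||k]; first exact: z_gt0.
        (* Probabilities of distinct players need not sum to 1; the equation [None] supplies this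
           simplex condition. *)
        have := eqs None; rewrite binary_term_sum => /eqP.
        by rewrite subr_eq0 => /eqP.
      by have := eqs (Some (inr k)); rewrite binary_term_sum ab.
    exists x => //; split=> //; apply/boundE => i.
    by rewrite -/(a i) -/(b i) ab ax.
  move=> [x Vx [z_gt0 /boundE zE]]; apply/totally_mixed_NEP => //; split=> // p j.
  case: (boolP (free p)) => [|fp]; last first.
    by rewrite !dev_payoff0 // => t; move: fp; rewrite /free /u; case: (enum_val p).
  rewrite /free; case Ep: (enum_val p) => [|e] // _.
  have {Ep} Ep : p = pe e by rewrite /pe -Ep enum_valK.
  move: j; rewrite Ep => j; rewrite !devE eqxx; case: ifP => // _.
  under eq_bigr => t _ do rewrite (zE t.1).1 (zE t.2).2.
  rewrite binary_term_sum; case: e {Ep j} => [[i0|k]|] /=; last by rewrite y_sum subrr.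
    by rewrite subrr.
  exact: VQ.
- move=> x z Vx [z_gt0 /boundE zE] k; rewrite peval_profile_poly.
  split; first by rewrite gt_eqF.
  rewrite yE peval_sum /linform -(zE ord0).1; congr (_ / _).
  by apply: eq_bigr => i _ /=; rewrite peval_profile_poly -(zE i).1.
Qed.

End Universality.

Theorem theorem1 (R : realType) (n : nat) (V : set 'rV[R]_n) :
  real_algebraic_variety V ->
  (exists (d : 'I_3 -> nat) (u : 'I_3 -> pure_profile d -> R),
     stably_isomorphic (RSet (totally_mixed_NE u)) (RSet V)) /\
  (exists (N : nat) (d : 'I_N -> nat) (u : 'I_N -> pure_profile d -> R),
     (forall i : 'I_N, d i = 1%N) /\
     stably_isomorphic (RSet (totally_mixed_NE u)) (RSet V)).
Proof.
by move=> Vv; split; [exact: three_player_game|exact: binary_game].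
Qed.
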